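(* Let $\phi$ be a formula of the language $\Phi$. If $\vdash\phi$, then $w\Vdash\phi$ for every epistemic world $w\in W$ of every Kripke model with evidence $\langle W,E,\{\sim_e\}_{e\in E},\pi\rangle$.
   Context: Fix an infinite set of propositional variables. The set $\Phi$ of formulae is given by $\phi ::= p \mid \neg\phi \mid \phi\to\phi \mid \boxdot\phi \mid \Box\phi$, where $p$ ranges over propositional variables. The logical system consists of all propositional tautologies in the language $\Phi$ together with the axioms (for all formulae $\phi,\psi$): Truth $\Box\phi\to\phi$; Negative Introspection $\neg\Box\phi\to\Box\neg\Box\phi$; Distributivity $\Box(\phi\to\psi)\to(\Box\phi\to\Box\psi)$; Monotonicity $\boxdot\phi\to\Box\phi$; Attainable Positive Introspection $\boxdot\phi\to\boxdot\boxdot\phi$; Attainable Distributivity $\boxdot(\phi\to\psi)\to(\boxdot\phi\to\boxdot\psi)$. The inference rules are Modus Ponens (from $\phi$ and $\phi\to\psi$ infer $\psi$) and Attainable Necessitation (from $\phi$ infer $\boxdot\phi$). We write $\vdash\phi$ if $\phi$ is derivable from the axioms using these two rules. A Kripke model with evidence is a tuple $\langle W,E,\{\sim_e\}_{e\in E},\pi\rangle$ where $W$ is a set (of epistemic worlds), $E$ is an arbitrary set (of evidence), each $\sim_e$ is an equivalence relation on $W$, and $\pi$ maps propositional variables to subsets of $W$. For $F\subseteq E$ write $w\sim_F u$ if $w\sim_e u$ for all $e\in F$. Satisfaction is defined by: $w\Vdash p$ iff $w\in\pi(p)$; $w\Vdash\neg\phi$ iff $w\nVdash\phi$; $w\Vdash\phi\to\psi$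 iff $w\nVdash\phi$ or $w\Vdash\psi$; $w\Vdash\boxdot\phi$ iff there is a finite $F\subseteq E$ such that $u\Vdash\phi$ for every $u\in W$ with $w\sim_F u$; $w\Vdash\Box\phi$ iff $u\Vdash\phi$ for every $u\in W$ with $w\sim_E u$. *)

(* Defs.v *)
From Stdlib Require Import Ensembles Finite_sets Relation_Definitions.

Set Implicit Arguments.
Unset Strict Implicit.

Inductive formula (V : Type) : Type :=
| Var (p : V)
| Neg (phi : formula V)
| Imp (phi psi : formula V)
| Att (phi : formula V) (* the attainable modality ⊡ *)
| Box (phi : formula V).

Arguments Var {V} p.
Arguments Neg {V} phi.
Arguments Imp {V} phi psi.
Arguments Att {V} phi.
Arguments Box {V} phi.

Declare Scope evidence_scope.
Delimit Scope evidence_scope with ev.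
Bind Scope evidence_scope with formula.
Notation "¬ phi" := (Neg phi)
  (at level 35, right associativity) : evidence_scope.
Notation "⊡ phi" := (Att phi)
  (at level 35, right associativity) : evidence_scope.
Notation "□ phi" := (Box phi)
  (at level 35, right associativity) : evidence_scope.
Notation "phi ⟶ psi" := (Imp phi psi)
  (at level 90, psi at level 90, right associativity) : evidence_scope.

(* For propositional purposes, variables and all modal formulae [⊡ phi],
   [□ phi] are atoms whose truth values are given by [a]; only the values of
   [a] at such formulae matter. *)
Fixpoint truth_value (V : Type) (a : formula V -> bool) (phi : formula V)
    : bool :=
  match phi with
  | Neg psi => negb (truth_value a psi)
  | Imp psi chi => implb (truth_value a psi) (truth_value a chi)
  | Var _ | Att _ | Box _ => a phi
  end.

Definition tautology (V : Type) (phi : formula V) : Prop :=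
  forall a : formula V -> bool, truth_value a phi = true.

Inductive derivable (V : Type) : formula V -> Prop :=
| ax_tautology phi : tautology phi -> derivable phi
| ax_truth phi : derivable (□ phi ⟶ phi)
| ax_negative_introspection phi : derivable (¬ □ phi ⟶ □ ¬ □ phi)
| ax_distributivity phi psi :
    derivable (□ (phi ⟶ psi) ⟶ (□ phi ⟶ □ psi))
| ax_monotonicity phi : derivable (⊡ phi ⟶ □ phi)
| ax_attainable_positive_introspection phi : derivable (⊡ phi ⟶ ⊡ ⊡ phi)
| ax_attainable_distributivity phi psi :
    derivable (⊡ (phi ⟶ psi) ⟶ (⊡ phi ⟶ ⊡ psi))
| modus_ponens phi psi :
    derivable phi -> derivable (phi ⟶ psi) -> derivable psi
| attainable_necessitation phi : derivable phi -> derivable (⊡ phi).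

Record evidence_model (V : Type) : Type := EvidenceModel {
  world : Type;
  evidence : Type;
  indist : evidence -> relation world;
  indist_equiv : forall e : evidence, equivalence world (indist e);
  valuation : V -> Ensemble world
}.

Arguments valuation {V} _ _.

Definition indist_set (V : Type) (M : evidence_model V)
    (F : Ensemble (evidence M)) (w u : world M) : Prop :=
  forall e : evidence M, In (evidence M) F e -> indist e w u.

Fixpoint sat (V : Type) (M : evidence_model V) (w : world M)
    (phi : formula V) : Prop :=
  match phi with
  | Var p => In (world M) (valuation M p) w
  | Neg psi => ~ sat w psi
  | Imp psi chi => ~ sat w psi \/ sat w chi
  | Att psi =>
      exists F : Ensemble (evidence M), Finite (evidence M) F /\
        forall u : world M, indist_set F w u -> sat u psi
  | Box psi =>
      forall u : world M, indist_set (Full_set (evidence M)) w u -> sat u psi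
  end.

(* Main.v *)
Require Import Defs.
From Stdlib Require Import Ensembles Finite_sets.
From Stdlib Require Import Relation_Definitions.
From Stdlib Require Import Classical ClassicalEpsilon.

(** Soundness goes by induction on the derivation, for all worlds of a fixed model at once.
    Tautologies hold because satisfaction at one world is itself a truth assignment
    ([truth_value_sat]). The modal axioms reflect that each [indist_set F] is an equivalence that
    gets finer as [F] grows: hence monotonicity, and hence attainable distributivity, where the two
    finite evidence sets are merged by [finite_upper_bound]. *)

Lemma indist_set_refl (V : Type) (M : evidence_model V)
  (F : Ensemble (evidence M)) (w : world M) : indist_set F w w.
Proof. intros e _. apply (equiv_refl _ _ (indist_equiv e)). Qed.

Lemma indist_set_sym (V : Type) (M : evidence_model V)
  (F : Ensemble (evidence M)) (w u : world M) :
  indist_set F w u -> indist_set F u w.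
Proof.
  intros wu e Fe. apply (equiv_sym _ _ (indist_equiv e)). exact (wu e Fe).
Qed.

Lemma indist_set_trans (V : Type) (M : evidence_model V)
  (F : Ensemble (evidence M)) (w u v : world M) :
  indist_set F w u -> indist_set F u v -> indist_set F w v.
Proof.
  intros wu uv e Fe.
  apply (equiv_trans _ _ (indist_equiv e)) with u; [exact (wu e Fe) | exact (uv e Fe)].
Qed.

Lemma indist_set_incl (V : Type) (M : evidence_model V)
  (F G : Ensemble (evidence M)) (w u : world M) :
  Included _ F G -> indist_set G w u -> indist_set F w u.
Proof. intros FG wu e Fe. apply wu, FG, Fe. Qed.

(* An upper bound suffices below; finiteness of the union itself would need
   extensionality of ensembles. *)
Lemma finite_upper_bound (U : Type) (F G : Ensemble U) :
  Finite U F -> Finite U G ->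
  exists H, Finite U H /\ Included U F H /\ Included U G H.
Proof.
  intros finF finG.
  induction finG as [| G finG [H [finH [FH GH]]] x _].
  - exists F. split; [exact finF |]. split; [intros y Fy; exact Fy |].
    intros y [].
  (* [Union_is_finite] only adds an element that is not already present. *)
  - destruct (classic (In U H x)) as [Hx | Hx].
    + exists H. split; [exact finH |]. split; [exact FH |].
      intros y [z Gz | z []]; [apply GH, Gz | exact Hx].
    + exists (Add U H x). split; [apply Union_is_finite; assumption |]. split.
      * intros y Fy. apply Union_introl, FH, Fy.
      * intros y [z Gz | z zx]; [apply Union_introl, GH, Gz | apply Union_intror, zx].
Qed.

Lemma sat_Imp (V : Type) (M : evidence_model V) (w : world M)
  (phi psi : formula V) : sat w (Imp phi psi) <-> (sat w phi -> sat w psi).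
Proof. simpl. destruct (classic (sat w phi)); tauto. Qed.

(** Variables and modal formulae are atoms, where [a] is read directly; negation and implication are
    evaluated classically on both sides. *)
Lemma truth_value_sat (V : Type) (M : evidence_model V) (w : world M)
  (a : formula V -> bool) (a_sat : forall psi, a psi = true <-> sat w psi)
  (phi : formula V) : truth_value a phi = true <-> sat w phi.
Proof.
  induction phi as [p | phi IH | phi IHphi psi IHpsi | phi _ | phi _];
    try apply a_sat.
  - simpl. rewrite <- IH. destruct (truth_value a phi); intuition discriminate.
  - rewrite sat_Imp, <- IHphi, <- IHpsi. simpl.
    destruct (truth_value a phi), (truth_value a psi); simpl; tauto.
Qed.

Lemma sat_tautology (V : Type) (phi : formula V) (M : evidence_model V)
  (w : world M) : tautology phi -> sat w phi.
Proof.
  intros taut.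
  apply (truth_value_sat V M w
    (fun psi => if excluded_middle_informative (sat w psi) then true else false));
    [| apply taut].
  intros psi. destruct (excluded_middle_informative (sat w psi));
    split; trivial; (discriminate || contradiction).
Qed.

Theorem theorem1 (V : Type) (V_infinite : ~ Finite V (Full_set V))
  (phi : formula V) (phi_derivable : derivable phi)
  (M : evidence_model V) (w : world M) : sat w phi.
Proof.
  (* Necessitation needs the induction hypothesis at every world, not only at [w]. *)
  revert w.
  induction phi_derivable as
    [phi taut | phi | phi | phi psi | phi | phi | phi psi
    | phi psi _ IHphi _ IHimp | phi _ IH]; intros w.
  - apply sat_tautology, taut.
  - apply sat_Imp. intros box. apply box, indist_set_refl.
  (* By symmetry and transitivity, every world indistinguishable from [w] is so from [u]; thus □ at
     [u] would give □ at [w]. *)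
  - apply sat_Imp. intros nbox u wu ubox. apply nbox. intros v wv.
    apply ubox. apply indist_set_trans with w; [apply indist_set_sym, wu | exact wv].
  - rewrite !sat_Imp. intros boximp box u wu.
    apply (proj1 (sat_Imp _ _ _ _ _) (boximp u wu)), box, wu.
  - apply sat_Imp. intros [F [_ HF]] u wu. apply HF.
    apply indist_set_incl with (2 := wu). intros e _. apply Full_intro.
  - apply sat_Imp. intros [F [finF HF]]. exists F. split; [exact finF |].
    (* The same [F] serves at [u], since [u] lies in the [F]-class of [w]. *)
    intros u wu. exists F. split; [exact finF |].
    intros v uv. apply HF, indist_set_trans with u; assumption.
  - rewrite !sat_Imp. intros [F [finF HF]] [G [finG HG]].
    destruct (finite_upper_bound _ _ _ finF finG) as [H [finH [FH GH]]].
    exists H. split; [exact finH |]. intros u wu.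
    apply (proj1 (sat_Imp _ _ _ _ _)
      (HF u (indist_set_incl _ _ _ _ _ _ FH wu))).
    apply HG, indist_set_incl with (1 := GH), wu.
  - exact (proj1 (sat_Imp _ _ _ _ _) (IHimp w) (IHphi w)).
  (* A formula true at all worlds is attainable from no evidence. *)
  - exists (Empty_set _). split; [apply Empty_is_finite |]. intros u _. apply IH.
Qed.
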